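(* Let $n$ be a positive integer, and let $\Theta_n = \{\theta_1, \ldots, \theta_n\}$ be a set of $n$ real numbers that are linearly independent over $\mathbf{Q}$. Let $h \geq 2$ be an integer, and let $$\varepsilon_{h,n} = \inf\left\{ \left| \sum_{i=1}^n (x_i - y_i)\theta_i \right| : \mathbf{x}, \mathbf{y} \in \mathcal{X}_{h,n},\ \mathbf{x} \neq \mathbf{y} \right\},$$ where $\mathcal{X}_{h,n} = \{ (x_1,\ldots,x_n) \in \mathbf{N}_0^n : \sum_{i=1}^n x_i = h\}$. Let $q$ and $m$ be positive integers with $$q > \frac{2hm}{\varepsilon_{h,n}}.$$ For each of the $(2m)^{n}$ choices of integers $a_1,\ldots,a_n$ satisfying $$0 < |a_i - q\theta_i| \leq m \quad \text{for all } i \in \{1,\ldots,n\},$$ put $A_{h,n}(q,m) = \{a_1,\ldots,a_n\}$. Then each of these sets $A_{h,n}(q,m)$ is a $B_h$-set of integers, and $$\|A_{h,n}(q,m)\|_\infty \leq q\,\|\Theta_n\|_\infty + m.$$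
   Context: $\mathbf{N}_0$ denotes the set of nonnegative integers. For a finite set of real numbers $V = \{v_1,\ldots,v_n\}$, $\|V\|_\infty = \max_{1\le i \le n} |v_i|$. A nonempty subset $A$ of an additive abelian group $G$ (here $G = \mathbf{Z}$) is a $B_h$-set if every $g \in G$ has at most one representation as a sum of $h$ not necessarily distinct elements of $A$, where representations differing only by a permutation of the summands are identified. For each $i$ there are exactly $2m$ integers $a_i$ with $0 < |a_i - q\theta_i| \le m$, so there are $(2m)^n$ choices in total. If $n = 1$, the infimum defining $\varepsilon_{h,n}$ is over the empty set and is read as $+\infty$, so that the condition on $q$ is vacuous. *)

(* Defs.v *)
From HB Require Import structures.
From mathcomp Require Import all_boot all_order all_algebra.
From mathcomp Require Import all_classical all_reals all_analysis.

Set Implicit Arguments.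
Unset Strict Implicit.
Unset Printing Implicit Defensive.

Import Order.TTheory GRing.Theory Num.Theory.

Local Open Scope classical_set_scope.
Local Open Scope ring_scope.

(* A representation of g is an h-tuple of elements of A summing to g, taken up
   to permutation of its entries. *)
Definition Bh_set (G : zmodType) (h : nat) (A : set G) : Prop :=
  A !=set0 /\
  forall (g : G) (s t : h.-tuple G),
    [set` s] `<=` A -> [set` t] `<=` A ->
    \sum_(x <- s) x = g -> \sum_(x <- t) x = g ->
    perm_eq s t.

(* Linear independence of an indexed family; in particular its members are
   pairwise distinct, so it amounts to linear independence of an n-element set. *)
Definition Q_lin_indep (R : realType) (n : nat) (theta : 'I_n -> R) : Prop :=
  forall c : 'I_n -> rat,
    \sum_(i < n) ratr (c i) * theta i = 0 -> forall i, c i = 0.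

Definition compositions (h n : nat) : set {ffun 'I_n -> nat} :=
  [set x : {ffun 'I_n -> nat} | (\sum_(i < n) x i)%N = h].
Arguments compositions : clear implicits.

(* The infimum is taken in \bar R, so that it is +oo over the empty set. *)
Definition epsilon (R : realType) (h n : nat) (theta : 'I_n -> R) : \bar R :=
  ereal_inf [set r : \bar R | exists x y : {ffun 'I_n -> nat},
    [/\ x \in compositions h n, y \in compositions h n, x != y &
        r = `|\sum_(i < n) ((x i)%:R - (y i)%:R) * theta i|%:E]].

(* The sup norm of the finite set {v_1, ..., v_n}; the default value 0 plays no
   role when n > 0, since all terms are nonnegative. *)
Definition supnorm (R : realType) (n : nat) (v : 'I_n -> R) : R :=
  \big[Num.max/0]_(i < n) `|v i|.

Definition choices (R : realType) (n : nat) (theta : 'I_n -> R) (q m : nat) :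
    set {ffun 'I_n -> int} :=
  [set a : {ffun 'I_n -> int} | forall i, 0 < `|(a i)%:~R - q%:R * theta i| <= m%:R].

(* Main.v *)
Require Import Defs.
From HB Require Import structures.
From mathcomp Require Import all_boot all_order all_algebra.
From mathcomp Require Import all_classical all_reals all_analysis.
From mathcomp Require Import zify lra.

Set Implicit Arguments.
Unset Strict Implicit.
Unset Printing Implicit Defensive.

Import Order.TTheory GRing.Theory Num.Theory.

Local Open Scope classical_set_scope.
Local Open Scope ring_scope.

(** If two multisets of indices, with multiplicity vectors x and y, give the
    same sum of a_i's, then q * sum_i (x_i - y_i) theta_i equals
    sum_i (x_i - y_i) (q theta_i - a_i), which is at most 2hm in absolute value.
    When x <> y the left-hand side is at least q epsilon_{h,n} > 2hm. *)

(* Counting away from t on either side gives exactly m integers per side within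
   distance m, whether or not t is itself an integer. *)
Definition nearby_int (R : realType) (m : nat) (t : R) (u : bool * 'I_m) : int :=
  if u.1 then Num.floor t + 1 + (u.2)%:Z else Num.ceil t - 1 - (u.2)%:Z.

Lemma nearby_int_gt (R : realType) m (t : R) (k : 'I_m) :
  t < (nearby_int t (true, k))%:~R.
Proof.
apply: lt_le_trans (floorD1_gt t) _.
by rewrite ler_int lerDl.
Qed.

Lemma nearby_int_lt (R : realType) m (t : R) (k : 'I_m) :
  (nearby_int t (false, k))%:~R < t.
Proof.
apply: le_lt_trans (ceilB1_lt t).
by rewrite ler_int gerBl.
Qed.

(** The value [t] separates the two sides, and on a single side the value is affine in the offset
    with slope 1 or -1. *)
Lemma nearby_int_inj (R : realType) m (t : R) : injective (@nearby_int R m t).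
Proof.
move=> [b k] [c l] e.
have lt_gt i j : nearby_int t (true, i : 'I_m) <> nearby_int t (false, j : 'I_m).
  move=> e'; have := lt_trans (nearby_int_lt t j) (nearby_int_gt t i).
  by rewrite e' ltxx.
case: b c e => [] [] e; [| by case: (lt_gt _ _ e) | by case: (lt_gt _ _ (esym e)) |];
  by congr pair; apply: val_inj; move: e; rewrite /nearby_int /=; lia.
Qed.

Lemma range_nearby_int (R : realType) m (t : R) :
  range (@nearby_int R m t) = [set a : int | 0 < `|a%:~R - t| <= m%:R].
Proof.
have fl := floor_le t; have ce := ceil_ge t.
apply/seteqP; split=> [_ [[b k] _ <-]|a] /=.
  (* The first integer strictly beyond [t] on either side lies within distance 1, so offset [k]
     gives distance at most [k + 1], and [k < m]. *)
  have km : (k%:R + 1 : R) <= m%:R by rewrite natr1 ler_nat.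
  case: b; [have := nearby_int_gt t k | have := nearby_int_lt t k].
    move=> lt_t; rewrite gtr0_norm ?subr_gt0 // lt_t /=.
    by rewrite /nearby_int /= !rmorphD /= -pmulrn; lra.
  move=> lt_t; rewrite ltr0_norm ?subr_lt0 // oppr_gt0 subr_lt0 lt_t /=.
  by rewrite /nearby_int /= !rmorphB /= -pmulrn; have := ceilB1_lt t; lra.
rewrite normr_gt0 subr_eq0 => /andP[].
case: (ltgtP a%:~R t) => // lt_at _.
- rewrite ltr0_norm ?subr_lt0 // opprB => le_m.
  have a_ub : a <= Num.ceil t - 1 by rewrite -ltzD1 subrK ceil_gt_int.
  have a_lb : Num.ceil t <= a + m%:Z.
    by rewrite ceil_le_int rmorphD /= -pmulrn; lra.
  (* The offset of [a] is its distance from [Num.ceil t - 1], the largest integer below [t]; [a_ub]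
     makes it nonnegative and [a_lb] at most [m - 1]. *)
  have ltm : (`|(Num.ceil t - 1 - a)%R| < m)%N by lia.
  exists (false, Ordinal ltm) => //=; rewrite /nearby_int /=; lia.
rewrite gtr0_norm ?subr_gt0 // => le_m.
have a_lb : Num.floor t + 1 <= a by rewrite lezD1 floor_lt_int.
have a_ub : a - m%:Z <= Num.floor t.
  by rewrite floor_ge_int rmorphB /= -pmulrn; lra.
have ltm : (`|(a - (Num.floor t + 1))%R| < m)%N by lia.
exists (true, Ordinal ltm) => //=; rewrite /nearby_int /=; lia.
Qed.

(** Links cardinality of sets with [#|T|], through the numbering [enum_rank]. *)
Lemma card_finType_setT (T : finType) : ([set: T] #= `I_#|T|)%card.
Proof.
have -> : `I_#|T| = range (val \o @enum_rank T).
  apply/seteqP; split=> [k /= lt_k|_ [x _ <-]] /=; last exact: ltn_ord.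
  by exists (enum_val (Ordinal lt_k)); rewrite //= enum_valK.
rewrite card_eq_sym; apply: inj_card_eq.
by move=> x y _ _ /val_inj/enum_rank_inj.
Qed.

(** The constraints on different coordinates are independent, so a choice amounts to a side and an
    offset below [m] for each index. *)
Lemma card_choices (R : realType) n (theta : 'I_n -> R) q m :
  (choices theta q m #= `I_((2 * m) ^ n))%card.
Proof.
pose f (u : {ffun 'I_n -> bool * 'I_m}) : {ffun 'I_n -> int} :=
  [ffun i => nearby_int (q%:R * theta i) (u i)].
have -> : choices theta q m = range f.
  apply/seteqP; split=> [a ch_a|_ [u _ <-] i]; last first.
    have : range (@nearby_int R m (q%:R * theta i)) (f u i).
      by exists (u i); rewrite ?ffunE.
    by rewrite range_nearby_int.
  have /choice[u ua] :
      forall i, exists v : bool * 'I_m, nearby_int (q%:R * theta i) v = a i.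
    move=> i; have : range (@nearby_int R m (q%:R * theta i)) (a i).
      by rewrite range_nearby_int; exact: ch_a.
    by case=> v _; exists v.
  by exists (finfun u) => //; apply/ffunP => i; rewrite !ffunE.
have f_inj : injective f.
  move=> u v /ffunP fuv; apply/ffunP => i; have := fuv i.
  by rewrite !ffunE => /nearby_int_inj.
rewrite (card_eql (inj_card_eq _)); last by move=> u v _ _ /f_inj.
have := card_finType_setT {ffun 'I_n -> bool * 'I_m}.
by rewrite card_ffun card_prod card_bool !card_ord.
Qed.

Lemma linear_form_gap (R : realType) (h n q m : nat) (theta : 'I_n -> R)
    (x y : {ffun 'I_n -> nat}) :
  ((2 * h * m)%:R%:E / epsilon h theta < q%:R%:E)%E ->
  (0 < 2 * h * m)%N ->
  compositions h n x -> compositions h n y -> x != y ->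
  (2 * h * m)%:R < q%:R * `|\sum_(i < n) ((x i)%:R - (y i)%:R) * theta i|.
Proof.
move=> gap hm_gt0 cx cy neq_xy; set L := `|_|.
have eps_le : (epsilon h theta <= L%:E)%E.
  by apply: ereal_inf_lbound; exists x, y; split=> //; rewrite inE.
have eps_ge0 : (0 <= epsilon h theta)%E.
  by apply: le_ereal_inf_tmp => _ [? [? [_ _ _ ->]]]; rewrite lee_fin.
(* The finite bound [L] excludes [+oo], and nonnegativity excludes [-oo]. For [n = 1] the infimum is
   [+oo], which is incompatible with [x != y]. *)
case: (epsilon h theta) eps_le eps_ge0 gap => [e| |] //.
rewrite !lee_fin => le_eL; rewrite le_eqVlt => /predU1P[<-|e_gt0].
  (* The inverse of 0 is +oo in \bar R, so the hypothesis excludes epsilon = 0. *)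
  by rewrite inve0 mulry gtr0_sg ?ltr0n // mul1e.
rewrite inver gt_eqF // -EFinM lte_fin ltr_pdivrMr // => /lt_le_trans; apply.
by rewrite ler_wpM2l.
Qed.

Definition multiplicities (I : finType) (h : nat) (u : h.-tuple I) :
  {ffun I -> nat} := [ffun i => count_mem i u].

Lemma sum_multiplicities (I : finType) (h : nat) (u : h.-tuple I) :
  (\sum_i multiplicities u i)%N = h.
Proof.
rewrite -[RHS](size_tuple u) -sum1_size [RHS](partition_big id xpredT) //=.
by apply: eq_bigr => i _; rewrite ffunE sum1_count.
Qed.

Lemma sum_map_multiplicities (V : nmodType) (I : finType) (h : nat)
    (u : h.-tuple I) (a : I -> V) :
  \sum_(x <- map a u) x = \sum_i a i *+ multiplicities u i.
Proof.
rewrite big_map [LHS](partition_big id xpredT) //=; apply: eq_bigr => i _.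
by rewrite ffunE -sum1_count -sumrMnr; apply: eq_bigr => j /eqP ->.
Qed.

Lemma multiplicities_perm_eq (I : finType) (h : nat) (u v : h.-tuple I) :
  multiplicities u = multiplicities v -> perm_eq u v.
Proof.
move=> /ffunP uv; apply/allP => i _ /=.
by have := uv i; rewrite !ffunE => ->.
Qed.

(** Moves the argument from values to indices. The preimages are chosen entry by entry, so [a] may
    repeat values. *)
Lemma tuple_range (I : finType) (T : eqType) (a : I -> T) (h : nat)
    (s : h.-tuple T) :
  [set` s] `<=` range a -> exists u : h.-tuple I, s = map a u :> seq T.
Proof.
move=> sa; have /choice[u us] : forall k : 'I_h, exists i, a i = tnth s k.
  by move=> k; have [i _] := sa _ (mem_tnth k s); exists i.
exists [tuple u k | k < h]; rewrite -map_comp [in LHS](tuple_map_ord s).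
by apply: eq_map => k /=; rewrite us.
Qed.

Lemma norm_linear_form_le (R : realType) (h n q m : nat) (theta : 'I_n -> R)
    (a : {ffun 'I_n -> int}) (x y : {ffun 'I_n -> nat}) :
  choices theta q m a -> compositions h n x -> compositions h n y ->
  \sum_i a i *+ x i = \sum_i a i *+ y i ->
  q%:R * `|\sum_(i < n) ((x i)%:R - (y i)%:R) * theta i| <= (2 * h * m)%:R.
Proof.
move=> ch_a cx cy eq_sum.
have sum0 : \sum_(i < n) ((x i)%:R - (y i)%:R) * (a i)%:~R = 0 :> R.
  have /eqP := congr1 (fun z : int => z%:~R : R) eq_sum.
  rewrite -subr_eq0 !rmorph_sum -sumrB /= => /eqP; apply: etrans.
  by apply: eq_bigr => i _; rewrite !rmorphMn /= mulrBl !mulr_natl.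
(* By [sum0] the [a i] contribute nothing, so each [q * theta i] can be traded for the approximation
   error [a i - q * theta i], up to a global sign. *)
have -> : q%:R * `|\sum_(i < n) ((x i)%:R - (y i)%:R) * theta i| =
    `|\sum_(i < n) ((x i)%:R - (y i)%:R) * ((a i)%:~R - q%:R * theta i)|.
  under [in RHS]eq_bigr do rewrite mulrBr mulrCA.
  by rewrite sumrB sum0 sub0r normrN -mulr_sumr normrM normr_nat.
apply: le_trans (ler_norm_sum _ _ _) _.
(* Each error is at most [m] and [|x i - y i| <= x i + y i]; these weights sum to [2 * h] because
   [x] and [y] both have total [h]. *)
apply: (@le_trans _ _ (\sum_(i < n) ((x i)%:R + (y i)%:R) * m%:R)).
  apply: ler_sum => i _; rewrite normrM ler_pM //.
    by rewrite (le_trans (ler_normB _ _)) // !normr_nat.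
  by have /andP[] := ch_a i.
by rewrite -mulr_suml big_split /= -!natr_sum cx cy -natrD -natrM addnn mul2n.
Qed.

Lemma supnorm_choices (R : realType) (n q m : nat) (theta : 'I_n -> R)
    (a : {ffun 'I_n -> int}) :
  choices theta q m a ->
  supnorm (fun i => (a i)%:~R : R) <= q%:R * supnorm theta + m%:R.
Proof.
(* The maximum starts from the default 0, so the bound must be shown nonnegative as well. *)
move=> ch_a; rewrite /supnorm; apply/bigmax_leP; split=> [|i _].
  by rewrite addr_ge0 // mulr_ge0 //; exact: bigmax_ge_id.
rewrite -[(a i)%:~R](addrNK (q%:R * theta i)) addrC.
apply: le_trans (ler_normD _ _) _; rewrite lerD //; last by have /andP[] := ch_a i.
by rewrite normrM normr_nat ler_wpM2l // le_bigmax.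
Qed.

Theorem theorem2 (R : realType) (n : nat) (hn : (0 < n)%N)
  (theta : 'I_n -> R) (htheta : Q_lin_indep theta)
  (h : nat) (hh : (2 <= h)%N)
  (q m : nat) (hq : (0 < q)%N) (hm : (0 < m)%N)
  (hqm : ((2 * h * m)%:R%:E / epsilon h theta < q%:R%:E)%E) :
  (choices theta q m #= `I_(((2 * m) ^ n)%N))%card /\
  forall a : {ffun 'I_n -> int}, choices theta q m a ->
    Bh_set h (range a) /\
    supnorm (fun i => (a i)%:~R : R) <= q%:R * supnorm theta + m%:R.
Proof.
split=> [|a ch_a]; first exact: card_choices.
split; last exact: supnorm_choices.
split=> [|g s t]; first by exists (a (Ordinal hn)), (Ordinal hn).
move=> /tuple_range[u ->] /tuple_range[v ->].
rewrite !sum_map_multiplicities => <- /esym eq_sum.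
(* It suffices that the index tuples [u] and [v] have equal multiplicities; if they differ, the
   lower and upper bounds on the linear form contradict each other. *)
apply/perm_map/multiplicities_perm_eq/eqP; apply: contraT => neq_uv.
have cu := sum_multiplicities u; have cv := sum_multiplicities v.
have hm_gt0 : (0 < 2 * h * m)%N by rewrite !muln_gt0 hm (ltnW hh).
have := linear_form_gap hqm hm_gt0 cu cv neq_uv.
by rewrite ltNge (norm_linear_form_le ch_a cu cv eq_sum).
Qed.
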